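(* Let $n\ge 2$, let $A$ be a real $n\times n$ matrix, and let $\Delta t>0$ be such that $\alpha_1(\Delta t)\neq 0$, where $\alpha_0,\dots,\alpha_{n-1}$ are the scalar coefficient functions associated with $A$ (defined in the context), and let $R_1(\Delta t,A)$ and (for invertible $A$) $R_0(\Delta t,A)$ be the correction factors defined in the context. (i) (Linear case.) Let $X$ be the solution on $[0,\infty)$ of $X'(t)=AX(t)$, and let $(X_k)_{k\in\mathbb{N}}$ be defined by $X_0=X(0)$ and $$\frac{X_{k+1}-\alpha_0(\Delta t)X_k}{\alpha_1(\Delta t)} = AX_k + R_1(\Delta t,A)\,AX_k .$$ Then $X_k = X(k\Delta t)$ for all $k\in\mathbb{N}$. (ii) (Constant forcing.) Assume in addition that $A$ is invertible, let $b\in\mathbb{R}^n$ be a constant vector, let $X$ be the solution on $[0,\infty)$ of $X'(t)=AX(t)+b$, and let $(X_k)_{k\in\mathbb{N}}$ be defined by $X_0=X(0)$ and $$\frac{X_{k+1}-\alpha_0(\Delta t)X_k}{\alpha_1(\Delta t)} = AX_k + b + R_1(\Delta t,A)\left[AX_k+b\right] + R_0(\Delta t,A)\,b .$$ Then $X_k = X(k\Delta t)$ for all $k\in\mathbb{N}$.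
   Context: Here $\mathbb{N}$ includes $0$ and $I$ is the $n\times n$ identity matrix. Coefficients $\alpha_j$. By the Cayley--Hamilton theorem, $A^n=\sum_{j=0}^{n-1}c_jA^j$, where the real numbers $c_j$ are determined by the characteristic polynomial: $\det(\lambda I-A)=\lambda^n-\sum_{j=0}^{n-1}c_j\lambda^j$. Define real numbers $\beta_{kj}$ for $k\ge 0$ and $0\le j\le n-1$ by - $\beta_{kj}=\delta_{kj}$ (Kronecker delta) if $k<n$; - $\beta_{nj}=c_j$; - $\beta_{k0}=c_0\beta_{k-1,n-1}$ if $k>n$; - $\beta_{kj}=c_j\beta_{k-1,n-1}+\beta_{k-1,j-1}$ if $k>n$ and $j>0$, so that $A^k=\sum_{j=0}^{n-1}\beta_{kj}A^j$ for all $k\ge 0$. Then $$\alpha_j(\Delta t)=\sum_{k=0}^{\infty}\frac{\Delta t^k}{k!}\beta_{kj},\qquad j=0,\dots,n-1,$$ and one has $e^{\Delta t A}=\sum_{j=0}^{n-1}\alpha_j(\Delta t)A^j$. Correction factors. For $\alpha_1(\Delta t)\ne 0$, $$R_1(\Delta t,A)=\sum_{j=2}^{n-1}\frac{\alpha_j(\Delta t)}{\alpha_1(\Delta t)}A^{j-1}$$ (an empty sum, hence $0$, if $n=2$), and, if $A$ is invertible, $$R_0(\Delta t,A)=\frac{\alpha_0(\Delta t)-1}{\alpha_1(\Delta t)}A^{-1}.$$ *)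

(* Defs.v *)
(* MathComp / MathComp-Analysis *)
From mathcomp Require Import all_boot all_order all_algebra.
From mathcomp Require Import all_classical all_reals all_analysis.

Set Implicit Arguments.
Unset Strict Implicit.
Unset Printing Implicit Defensive.

Import Order.TTheory GRing.Theory Num.Theory.
Import numFieldNormedType.Exports.

Local Open Scope classical_set_scope.
Local Open Scope ring_scope.

Section Coefficients.
Context {R : realType} {n : nat}.
Implicit Types (A : 'M[R]_n) (dt : R).

(* det(λI - A) = λ^n - \sum_(j < n) c_j λ^j; only used for j < n. *)
Definition chcoef A (j : nat) : R := - (char_poly A)`_j.

(* A^k = \sum_(j < n) beta A k j *: A^j. The first test leaves [0 => 0]
   unreachable for n > 0; the recursion only involves column indices < n when
   it is started at j < n. *)
Fixpoint beta A (k j : nat) {struct k} : R :=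
  if (k < n)%N then (k == j)%:R
  else if k == n then chcoef A j
  else match k with
       | 0 => 0
       | k'.+1 =>
           match j with
           | 0 => chcoef A 0 * beta A k' n.-1
           | j'.+1 => chcoef A j'.+1 * beta A k' n.-1 + beta A k' j'
           end
       end.

Definition alpha A (j : nat) dt : R :=
  limn (series (fun k : nat => dt ^+ k / k`!%:R * beta A k j)).

Definition R1 A dt : 'M[R]_n :=
  \sum_(2 <= j < n) (alpha A j dt / alpha A 1 dt) *: A ^+ j.-1.

Definition R0 A dt : 'M[R]_n :=
  ((alpha A 0 dt - 1) / alpha A 1 dt) *: invmx A.

(* X solves X' = F(X) on [0, +oo[: the values of X on ]-oo, 0[ are irrelevant,
   and the derivative at 0 is the right derivative. *)
Definition ode_solution (F : 'cV[R]_n -> 'cV[R]_n) (X : R -> 'cV[R]_n) : Prop :=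
  (forall t : R, 0 < t -> is_derive t 1 X (F (X t))) /\
  h^-1 *: (X h - X 0) @[h --> 0^'+] --> F (X 0).

End Coefficients.

(* Main.v *)
Require Import Defs.
From mathcomp Require Import all_boot all_order all_algebra.
From mathcomp Require Import ring.
From mathcomp Require Import all_classical all_reals all_analysis.
Import Order.TTheory GRing.Theory Num.Theory.
Import numFieldNormedType.Exports.
Local Open Scope ring_scope.

(** The columns of [beta] satisfy one linear recursion for every [k], so that
    [alpha_j' = c_j alpha_(n-1) + alpha_(j-1)] and [alpha_j 0 = delta_(j0)].
    With Cayley-Hamilton, [P t := \sum_j alpha_j t *: A ^+ j] then satisfies
    [P' = P A] and [P 0 = 1], so [s |-> P (b - s) *m X s] has zero derivative
    along a solution of [X' = A X] and [X b = P (b - a) *m X a].  Solved for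
    [x k.+1], the scheme reads [x k.+1 = P dt *m x k]; constant forcing reduces
    to this by the translation [X + A^-1 b]. *)

(** * Growth and generating series of the coefficients *)

Section Coefficients.
Context {R : realType} {n : nat}.
Implicit Types (A : 'M[R]_n) (t : R).

Lemma beta0 A j : (0 < n)%N -> beta A 0 j = (0 == j)%N%:R.
Proof. by move=> n_gt0; rewrite /= n_gt0. Qed.

(** For [k.+1 < n] the factor [beta A k n.-1] vanishes and the recursion is a pure shift; for
    [k.+1 = n] that factor is 1 and the shifted term vanishes; beyond [n] this is the definition. *)
Lemma betaS A k j : (j < n)%N ->
  beta A k.+1 j =
  chcoef A j * beta A k n.-1 + (if j is j'.+1 then beta A k j' else 0).
Proof.
move=> jn; have n_gt0 : (0 < n)%N by apply: leq_ltn_trans jn.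
have small k' j' : (k' < n)%N -> beta A k' j' = (k' == j')%:R.
  by case: k' => [|k'] kn /=; rewrite kn.
case: (ltngtP k.+1 n) => [kn|nk|kn].
- rewrite !small// ?(ltnW kn)// [k == n.-1]ltn_eqF; last first.
    by rewrite -ltnS prednK.
  rewrite mulr0 add0r; case: j jn => [|j'] _ //.
  by rewrite small// ltnW.
- rewrite [LHS]/= ltnNge (ltnW nk) [k.+1 == n]gtn_eqF//=.
  by case: j jn => // _; rewrite addr0.
- have kpn : n.-1 = k by rewrite -kn.
  have [kn' knF] : (k < n)%N /\ (k.+1 < n)%N = false by rewrite -kn ltnn leqnn.
  rewrite [LHS]/= knF kn eqxx kpn (small k)// eqxx mulr1.
  case: j jn => [|j] jn; first by rewrite addr0.
  by rewrite small// [k == j]gtn_eqF ?addr0// -ltnS kn.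
Qed.

(** One step of the recursion enlarges a uniform bound at most by the factor [C + 1]: [C] dominates
    every coefficient [chcoef A j], and 1 accounts for the shifted term. *)
Lemma beta_le A : exists2 M : R, 0 <= M &
  forall k j, (j < n)%N -> `|beta A k j| <= M ^+ k.
Proof.
pose C := \sum_(j < n) `|chcoef A j|.
have C_ge0 : 0 <= C by apply: sumr_ge0.
exists (C + 1); first by rewrite addr_ge0.
elim=> [|k IH] j jn.
  rewrite beta0 ?(leq_ltn_trans _ jn)// expr0.
  by case: eqP; rewrite ?normr1 ?normr0.
rewrite betaS// (le_trans (ler_normD _ _))// exprS mulrDl mul1r lerD//.
  rewrite normrM ler_pM//; last first.
    by apply: IH; rewrite prednK ?(leq_ltn_trans _ jn).
  by rewrite /C (bigD1 (Ordinal jn))//= lerDl sumr_ge0.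
case: j jn => [|j] jn; last by rewrite IH// ltnW.
by rewrite normr0 exprn_ge0// addr_ge0.
Qed.

Lemma alphaE A j : alpha A j =
  fun t => limn (pseries (fun k => (k`!%:R)^-1 * beta A k j) t).
Proof.
apply/funext => t; rewrite /alpha /pseries.
rewrite (_ : (fun k => _) = fun k => (k`!%:R)^-1 * beta A k j * t ^+ k)//.
by apply/funext => k; rewrite -mulrA mulrC.
Qed.

(** Comparison with [a] times the exponential series at [M * |x|]. *)
Lemma is_cvg_pseries_fact (c : nat -> R) (a M x : R) : 0 <= a -> 0 <= M ->
  (forall k, `|c k| <= a * M ^+ k) ->
  cvgn (pseries (fun k => (k`!%:R)^-1 * c k) x).
Proof.
move=> a_ge0 M_ge0 cM; apply: normed_cvg.
apply: (@series_le_cvg _ _ (a *: exp_coeff (M * `|x|))) => [k|k|k|].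
- exact: normr_ge0.
- by apply: mulr_ge0 => //; exact/exp_coeff_ge0/mulr_ge0.
- rewrite /= !normrM normrX ger0_norm ?invr_ge0//.
  rewrite [leRHS](_ : _ = (k`!%:R)^-1 * (a * M ^+ k) * `|x| ^+ k).
    by rewrite ler_wpM2r ?exprn_ge0// ler_wpM2l ?invr_ge0.
  by rewrite -[LHS]/(a * exp_coeff _ k) /exp_coeff /= exprMn; ring.
- by apply: is_cvg_seriesZ; exact: is_cvg_series_exp_coeff.
Qed.

Lemma pseries_diffs_fact (c : nat -> R) :
  pseries_diffs (fun k => (k`!%:R)^-1 * c k) =
  fun k => (k`!%:R)^-1 * c k.+1.
Proof.
apply/funext => k; rewrite /pseries_diffs factS natrM invfM !mulrA.
by rewrite divff ?mul1r// pnatr_eq0.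
Qed.

(** Formal differentiation of these series shifts the coefficients by one, so [k0] counts
    derivatives: termwise differentiation asks for convergence with [k0] equal to 0, 1 and 2. *)
Lemma is_cvg_alpha A k0 j t : (j < n)%N ->
  cvgn (pseries (fun k => (k`!%:R)^-1 * beta A (k0 + k) j) t).
Proof.
move=> jn; have [M M_ge0 bM] := beta_le A.
apply: (@is_cvg_pseries_fact _ (M ^+ k0) M) => //; first exact: exprn_ge0.
by move=> k; rewrite -exprD bM.
Qed.

Lemma is_derive_alpha A j t : (j < n)%N ->
  is_derive t 1 (alpha A j)
    (chcoef A j * alpha A n.-1 t + (if j is j'.+1 then alpha A j' t else 0)).
Proof.
move=> jn; have n_gt0 : (0 < n)%N by apply: leq_ltn_trans jn.
have pn : (n.-1 < n)%N by rewrite prednK.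
have -> : chcoef A j * alpha A n.-1 t +
    (if j is j'.+1 then alpha A j' t else 0) =
  limn (pseries (pseries_diffs (fun k => (k`!%:R)^-1 * beta A k j)) t).
  rewrite pseries_diffs_fact.
  case: j jn => [|j] jn; rewrite !alphaE /pseries.
    rewrite addr0 -[LHS]lim_seriesZ; last exact: (@is_cvg_alpha A 0).
    congr (limn (series _)); apply/funext => k.
    rewrite -[RHS]/((k`!%:R)^-1 * beta A k.+1 0 * t ^+ k) betaS//.
    by rewrite -[LHS]/(_ * ((k`!%:R)^-1 * beta A k n.-1 * t ^+ k)); ring.
  rewrite -[X in X + _]lim_seriesZ; last exact: (@is_cvg_alpha A 0).
  rewrite -lim_seriesD; last 2 first.
  - by apply: is_cvg_seriesZ; exact: (@is_cvg_alpha A 0).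
  - by apply: (@is_cvg_alpha A 0); exact: ltnW.
  congr (limn (series _)); apply/funext => k.
  rewrite -[RHS]/((k`!%:R)^-1 * beta A k.+1 j.+1 * t ^+ k) betaS//.
  rewrite -[LHS]/(_ * ((k`!%:R)^-1 * beta A k n.-1 * t ^+ k) +
                  (k`!%:R)^-1 * beta A k j * t ^+ k).
  by ring.
(* The series converge everywhere, so any radius above [|t|] will do. *)
rewrite alphaE; apply: (@pseries_snd_diffs _ _ (`|t| + 1)).
- exact: (@is_cvg_alpha A 0).
- by rewrite pseries_diffs_fact; exact: (@is_cvg_alpha A 1).
- by rewrite !pseries_diffs_fact; exact: (@is_cvg_alpha A 2).
- by rewrite [ltRHS]ger0_norm ?addr_ge0// ltrDl.
Qed.

Lemma alpha0 A j : (j < n)%N -> alpha A j 0 = (j == 0)%N%:R.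
Proof.
move=> jn; have n_gt0 : (0 < n)%N by apply: leq_ltn_trans jn.
(* At 0 only the term [k = 0] survives, so the partial sums are constant from index 1 on. *)
rewrite alphaE; apply/cvg_lim => //; rewrite -cvg_shiftS /pseries.
rewrite (_ : (fun k => _) = cst (j == 0)%N%:R); first exact: cvg_cst.
apply/funext => k; rewrite /series /= big_nat_recl//= n_gt0 fact0 invr1.
rewrite expr0 mulr1 mul1r eq_sym big1 ?addr0// => i _.
by rewrite expr0n mulr0.
Qed.

(** This is the matrix exponential of [t *: A]. *)
Definition propagator A t : 'M[R]_n := \sum_(j < n) alpha A j t *: A ^+ j.

End Coefficients.

(** Cayley-Hamilton with the monic leading term isolated; the sign in [chcoef] absorbs the change of
    side. *)
Lemma expmx_chcoef (R : realType) n (A : 'M[R]_n) : (0 < n)%N ->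
  A ^+ n = \sum_(j < n) chcoef A j *: A ^+ j.
Proof.
case: n A => // n A _; have := Cayley_Hamilton A.
rewrite -[in horner_mx _ _](coefK (char_poly A)) size_char_poly.
rewrite poly_def linear_sum /=.
under eq_bigr do rewrite linearZ /= rmorphXn /= horner_mx_X.
rewrite big_ord_recr /=.
have -> : (char_poly A)`_n.+1 = 1.
  have /monicP := char_poly_monic A.
  by rewrite lead_coefE size_char_poly.
rewrite scale1r addrC => /eqP; rewrite addr_eq0 => /eqP ->.
by rewrite -sumrN; apply: eq_bigr => i _; rewrite /chcoef scaleNr.
Qed.

(** * The initial value problem satisfied by the propagator *)

Section Propagator.
Context {R : realType} {n : nat} (A : 'M[R]_n).
Hypothesis n_gt0 : (0 < n)%N.

Lemma propagator0 : propagator A 0 = 1%:M.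
Proof.
rewrite /propagator (bigD1 (Ordinal n_gt0))//= alpha0// eqxx scale1r expr0.
rewrite big1 ?addr0// => j j0; rewrite alpha0//.
have /negbTE -> : nat_of_ord j != 0%N by exact: j0.
by rewrite scale0r.
Qed.

(** Multiplication by [A] raises each power by one, and Cayley-Hamilton folds the top power back.
    The resulting coefficients are the derivatives found in [is_derive_alpha]. *)
Lemma propagator_mulmx t : propagator A t *m A = \sum_(j < n)
  (chcoef A j * alpha A n.-1 t +
   (if nat_of_ord j is j'.+1 then alpha A j' t else 0) : R)
    *: A ^+ j.
Proof.
under [RHS]eq_bigr do rewrite scalerDl mulrC -scalerA.
rewrite big_split /= -scaler_sumr -expmx_chcoef// /propagator mulmx_suml.
transitivity (\sum_(j < n) alpha A j t *: A ^+ j.+1).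
  by apply: eq_bigr => j _; rewrite -scalemxAl exprSr.
case: n n_gt0 A => // m _ B.
by rewrite big_ord_recr big_ord_recl /= scale0r add0r addrC.
Qed.

Lemma is_derive_propagator (t : R) i k :
  is_derive t 1 (fun t : R => propagator A t i k) ((propagator A t *m A) i k).
Proof.
rewrite propagator_mulmx summxE.
rewrite (_ : (fun t => _) = \sum_(j < n) ((A ^+ j) i k \*: alpha A j));
  last first.
  apply/funext => s; rewrite summxE fct_sumE; apply: eq_bigr => j _.
  by rewrite mxE mulrC.
under [X in is_derive _ _ _ X]eq_bigr do rewrite mxE mulrC.
by apply: is_derive_sum => j; apply: is_deriveZ; exact: is_derive_alpha.
Qed.

End Propagator.

(** * Entrywise calculus for matrix-valued functions *)

Section MatrixFunctions.
Local Open Scope classical_set_scope.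
Context {R : realType} {m p q : nat}.
Implicit Types s t h : R.

Lemma is_derive_mulmx (M dM : R -> 'M[R]_(m, p)) (N dN : R -> 'M[R]_(p, q)) t :
  (forall i j, is_derive t 1 (fun s : R => M s i j) (dM t i j)) ->
  (forall i j, is_derive t 1 (fun s : R => N s i j) (dN t i j)) ->
  forall i j, is_derive t 1 (fun s : R => (M s *m N s) i j)
    ((dM t *m N t + M t *m dN t) i j).
Proof.
move=> dMt dNt i j.
rewrite (_ : (fun s => _) =
  \sum_(k < p) ((fun s => M s i k) * (fun s => N s k j))).
  have -> : (dM t *m N t + M t *m dN t) i j =
    \sum_(k < p) (M t i k *: dN t k j + N t k j *: dM t i k).
    rewrite !mxE -big_split /=; apply: eq_bigr => k _.
    by rewrite addrC; congr (_ + _); exact: mulrC.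
  by apply: is_derive_sum => k; exact: is_deriveM.
by apply/funext => s; rewrite mxE fct_sumE.
Qed.

Lemma cvg_mulmx (F : set_system R)
    (M : R -> 'M[R]_(m, p)) (N : R -> 'M[R]_(p, q))
    (M0 : 'M[R]_(m, p)) (N0 : 'M[R]_(p, q)) :
  Filter F ->
  (forall i j, M s i j @[s --> F] --> M0 i j) ->
  (forall i j, N s i j @[s --> F] --> N0 i j) ->
  forall i j, (M s *m N s) i j @[s --> F] --> (M0 *m N0) i j.
Proof.
move=> FF cM cN i j; rewrite mxE.
under eq_fun do rewrite mxE.
by apply: (@cvg_big _ _ +%R) => [|k _]; [exact: add_continuous|exact: cvgM].
Qed.

Lemma is_derive_coord (M : R -> 'M[R]_(m, p)) t dM : is_derive t 1 M dM ->
  forall i j, is_derive t 1 (fun s : R => M s i j) (dM i j).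
Proof.
move=> dMt i j; have Mt : derivable M t 1 by exact: ex_derive.
have Mij : derivable (fun s : R => M s i j) t 1.
  by move/derivable_mxP : Mt; exact.
apply: DeriveDef => //; rewrite -(@derive_val _ _ _ _ _ _ _ dMt) derive_mx//.
by rewrite mxE.
Qed.

Lemma is_derive_continuous (f : R -> R) t df :
  is_derive t 1 f df -> {for t, continuous f}.
Proof.
move=> ft; apply/differentiable_continuous/derivable1_diffP.
exact: ex_derive.
Qed.

Lemma right_derivable_cvg (M : R -> 'M[R]_(m, p)) (D : 'M[R]_(m, p)) :
  h^-1 *: (M h - M 0) @[h --> 0^'+] --> D ->
  forall i j, M s i j @[s --> 0^'+] --> M 0 i j.
Proof.
move=> cD i j.
have cDij : (h^-1 *: (M h - M 0)) i j @[h --> 0^'+] --> D i j.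
  exact: (cvg_comp _ (fun N : 'M[R]_(m, p) => N i j) cD
    (@coord_continuous R m p i j D)).
have ch : (h : R) @[h --> 0^'+] --> (0 : R).
  exact: (cvg_at_right_filter cvg_id).
(* For [h != 0] the left side is [M h i j], and [h] times a convergent quotient tends to 0. *)
have cM : M 0 i j + h * (h^-1 *: (M h - M 0)) i j @[h --> 0^'+] --> M 0 i j.
  rewrite -[X in _ --> X]addr0 -[X in _ + X](mul0r (D i j)).
  by apply: cvgD; [exact: cvg_cst | exact: cvgM].
refine (cvg_trans _ cM); apply: near_eq_cvg; near=> h.
by rewrite !mxE mulVKf ?subrKC//.
Unshelve. all: by end_near. Qed.

End MatrixFunctions.

(** * Solutions of the linear equation *)

Lemma ode_solution_cvg_right (R : realType) n (F : 'cV[R]_n -> 'cV[R]_n)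
    (X : R -> 'cV[R]_n) (a : R) : ode_solution F X -> 0 <= a ->
  forall i j, (X s i j @[s --> a^'+] --> X a i j)%classic.
Proof.
(* At [a = 0] only the right difference quotient is controlled; at [a > 0] differentiability gives
   two-sided continuity. *)
move=> [dX dX0]; rewrite le_eqVlt => /predU1P[<-|a_gt0] i j.
  exact: right_derivable_cvg dX0 i j.
apply: cvg_at_right_filter.
exact: is_derive_continuous (is_derive_coord _ _ _ (dX a a_gt0) i j).
Qed.

Lemma linear_ode_solutionE (R : realType) n (A : 'M[R]_n) (X : R -> 'cV[R]_n)
    (a b : R) : (0 < n)%N -> ode_solution (fun v => A *m v) X ->
  0 <= a -> a <= b -> X b = propagator A (b - a) *m X a.
Proof.
move=> n_gt0 solX a_ge0; rewrite le_eqVlt => /predU1P[<-|ab].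
  by rewrite subrr propagator0// mul1mx.
apply/colP => i.
pose f (s : R) : R := (propagator A (b - s) *m X s) i 0.
have dP (s : R) i' k : is_derive s 1 (fun s : R => propagator A (b - s) i' k)
    ((- (propagator A (b - s) *m A)) i' k).
  have dB : is_derive s 1 (fun s : R => b - s) (-1 : R).
    rewrite -[X in is_derive _ _ _ X]sub0r.
    exact: (@is_deriveB _ _ _ (cst b) id).
  have := @is_derive1_comp _ (fun u => propagator A u i' k) (fun s : R => b - s)
    _ _ _ (is_derive_propagator A n_gt0 (b - s) i' k) dB.
  by rewrite mulrN1 [X in _ -> is_derive _ _ _ X]mxE; exact.
have df (s : R) : 0 < s -> is_derive s 1 f 0.
  move=> s_gt0; have [dX _] := solX.
  have := @is_derive_mulmx _ _ _ _ _ (fun s => - (propagator A (b - s) *m A)) _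
    (fun s => A *m X s) s (dP s) (is_derive_coord _ _ _ (dX s s_gt0)) i 0.
  by rewrite mulNmx mulmxA addNr mxE.
have gt0_itv s : s \in `]a, b[ -> 0 < s.
  by rewrite in_itv /= => /andP[+ _]; exact: le_lt_trans.
(* Since [a] may be 0, where [X] has only a right derivative, the left endpoint is treated by
   one-sided limits of both factors. *)
have cf : {within `[a, b], continuous f}%classic.
  apply/continuous_within_itvP => //; split.
  - by move=> s /gt0_itv s_gt0; exact: is_derive_continuous (df s s_gt0).
  - apply: cvg_mulmx; last exact: ode_solution_cvg_right solX a_ge0.
    move=> i' k; apply: cvg_at_right_filter.
    exact: is_derive_continuous (dP a i' k).
  - apply: cvg_at_left_filter.
    exact: is_derive_continuous (df b (le_lt_trans a_ge0 ab)).
have [c _] := MVT ab (fun s sab => df s (gt0_itv s sab)) cf.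
rewrite mul0r => /eqP; rewrite subr_eq0 => /eqP.
by rewrite /f subrr propagator0// mul1mx.
Qed.

(** * The scheme as one application of the propagator *)

Section Scheme.
Context {R : realType} {n : nat} (A : 'M[R]_n) (dt : R).
Hypotheses (n_ge2 : (2 <= n)%N) (alpha1 : alpha A 1 dt != 0).

(** Split off the terms [j = 0] and [j = 1]. In the others, [R1] has divided by [alpha A 1 dt] and
    dropped one factor [A]; the scalar in front and the product with [A] restore both. *)
Lemma propagatorE :
  propagator A dt = (alpha A 0 dt)%:M + alpha A 1 dt *: (A + R1 A dt *m A).
Proof.
rewrite /propagator -(big_mkord xpredT (fun j => alpha A j dt *: A ^+ j)).
rewrite big_ltn ?(ltnW n_ge2)// big_ltn// expr0 expr1 scalemx1 scalerDr.
congr (_ + (_ + _)); rewrite /R1 mulmx_suml scaler_sumr.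
apply: eq_big_nat => -[|j]// _.
by rewrite -scalemxAl scalerA mulrCA divff// mulr1 exprSr.
Qed.

Lemma explicit_stepE (y z c : 'cV[R]_n) :
  (alpha A 1 dt)^-1 *: (z - alpha A 0 dt *: y) = c ->
  z = alpha A 0 dt *: y + alpha A 1 dt *: c.
Proof. by move=> <-; rewrite scalerA divff// scale1r subrKC. Qed.

Lemma linear_stepE (y z : 'cV[R]_n) :
  (alpha A 1 dt)^-1 *: (z - alpha A 0 dt *: y) = A *m y + R1 A dt *m (A *m y) ->
  z = propagator A dt *m y.
Proof.
move/explicit_stepE ->; rewrite propagatorE mulmxDl mul_scalar_mx.
by rewrite -scalemxAl mulmxDl mulmxA.
Qed.

(** With [v = invmx A *m b], the forcing enters through [A *m y + b = A *m (y + v)]. The [R0] term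
    contributes [(alpha A 0 dt - 1) *: v], so adding [v] completes [alpha A 0 dt *: y] to
    [alpha A 0 dt *: (y + v)]. *)
Lemma affine_stepE (b y z : 'cV[R]_n) : A \in unitmx ->
  (alpha A 1 dt)^-1 *: (z - alpha A 0 dt *: y) =
    A *m y + b + R1 A dt *m (A *m y + b) + R0 A dt *m b ->
  z + invmx A *m b = propagator A dt *m (y + invmx A *m b).
Proof.
move=> Au /explicit_stepE ->; rewrite propagatorE.
set v := invmx A *m b.
have -> : b = A *m v by rewrite mulKVmx.
rewrite -mulmxDr mulmxDl mul_scalar_mx -scalemxAl mulmxDl -mulmxA.
rewrite /R0 -scalemxAl mulKmx// -/v.
rewrite [in LHS]scalerDr scalerA mulrCA divff// mulr1.
rewrite scalerBl scale1r [alpha A 0 dt *: (y + v)]scalerDr !scalerDr -!addrA.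
by rewrite addNr addr0 [alpha A 0 dt *: v + _]addrC -!addrA.
Qed.

Lemma linear_scheme_exact (X : R -> 'cV[R]_n) (x : nat -> 'cV[R]_n) :
  0 <= dt -> ode_solution (fun v => A *m v) X -> x 0%N = X 0 ->
  (forall k, x k.+1 = propagator A dt *m x k) ->
  forall k, x k = X (k%:R * dt).
Proof.
move=> dt_ge0 solX x0 xS; have n_gt0 := ltnW n_ge2.
elim=> [|k IH]; first by rewrite mul0r.
have kdt_ge0 : 0 <= k%:R * dt by rewrite mulr_ge0.
have kS : k.+1%:R * dt = k%:R * dt + dt by rewrite mulrSr mulrDl mul1r.
rewrite xS IH kS.
rewrite (linear_ode_solutionE _ _ _ _ _ (_ + dt) n_gt0 solX kdt_ge0) ?lerDl//.
by rewrite addrAC subrr add0r.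
Qed.

End Scheme.

(** The constant [v] drops out of derivatives and difference quotients, while [A *m (X t + v)]
    equals [A *m X t + b]. *)
Lemma ode_solution_translate (R : realType) n (A : 'M[R]_n) (b v : 'cV[R]_n)
    (X : R -> 'cV[R]_n) : A *m v = b ->
  ode_solution (fun w => A *m w + b) X ->
  ode_solution (fun w => A *m w) (fun t => X t + v).
Proof.
move=> <- [dX dX0]; split=> [t t_gt0|].
  have dXt := dX t t_gt0; rewrite -mulmxDr in dXt.
  rewrite -[A *m _]addr0.
  exact: (@is_deriveD _ _ _ X (cst v)).
rewrite mulmxDr (_ : (fun h => _) = (fun h => h^-1 *: (X h - X 0)))//.
by apply/funext => h; rewrite opprD addrACA subrr addr0.
Qed.

Theorem mainTheorem1 (R : realType) (n : nat) (hn : (2 <= n)%N)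
    (A : 'M[R]_n) (dt : R) (hdt : 0 < dt) (halpha1 : alpha A 1 dt != 0) :
  (forall (X : R -> 'cV[R]_n) (x : nat -> 'cV[R]_n),
      ode_solution (fun v => A *m v) X ->
      x 0%N = X 0 ->
      (forall k : nat,
          (alpha A 1 dt)^-1 *: (x k.+1 - alpha A 0 dt *: x k)
          = A *m x k + R1 A dt *m (A *m x k)) ->
      forall k : nat, x k = X (k%:R * dt))
  /\
  (A \in unitmx ->
   forall (b : 'cV[R]_n) (X : R -> 'cV[R]_n) (x : nat -> 'cV[R]_n),
      ode_solution (fun v => A *m v + b) X ->
      x 0%N = X 0 ->
      (forall k : nat,
          (alpha A 1 dt)^-1 *: (x k.+1 - alpha A 0 dt *: x k)
          = A *m x k + b + R1 A dt *m (A *m x k + b) + R0 A dt *m b) ->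
      forall k : nat, x k = X (k%:R * dt)).
Proof.
split=> [X x solX x0 xS|Au b X x solX x0 xS k].
  apply: (linear_scheme_exact A dt hn X x (ltW hdt) solX x0) => k.
  exact: linear_stepE.
pose v := invmx A *m b.
have Avb : A *m v = b by rewrite mulKVmx.
(* Adding [v] to both sides turns the claim into the linear case for the translated sequence and
   solution. *)
apply: (addIr v).
apply: (linear_scheme_exact A dt hn (fun t => X t + v)
  (fun k => x k + v) (ltW hdt)).
- exact: ode_solution_translate Avb solX.
- by rewrite x0.
- by move=> j; exact: affine_stepE.
Qed.
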